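(* Let $L$ be a nonempty continuous dcpo. Then the following are equivalent: (a) for every core-compact topological space $X$, the Isbell topology and the Scott topology on $C(X,L)$ coincide, i.e. $\operatorname{Is}(C(X,L))=\sigma(C(X,L))$; (b) $L$ is bounded complete.
   Context: Directed sets are nonempty. A dcpo is a poset in which every directed subset has a supremum. For $u,x$ in a dcpo $P$, $u\ll x$ means that whenever $D\subseteq P$ is directed and $x\le\sup D$, some $d\in D$ satisfies $u\le d$. $P$ is continuous if for every $x\in P$ the set $\{u:u\ll x\}$ is directed with supremum $x$. $P$ is bounded complete if every subset having an upper bound, including the empty subset, has a supremum. A subset of a dcpo $P$ is Scott open if it is upward closed and inaccessible by directed suprema; $\sigma(P)$ is the topology of Scott-open sets. For a topological space $X$, $\mathcal O(X)$ is its lattice of open sets ordered by inclusion; $X$ is core compact if $\mathcal O(X)$ is a continuous dcpo. $C(X,L)$ is the set of continuous maps from $X$ to $(L,\sigma(L))$, ordered pointwise; it is a dcpo with directed suprema computed pointwise, and $\sigma(C(X,L))$ is its Scott topology. The Isbell topology $\operatorname{Is}(C(X,L))$ is generated (as a subbase) by the sets $[\mathcal H,V]=\{f\in C(X,L):f^{-1}(V)\in\mathcal H\}$, where $\mathcal H\subseteq\mathcal O(X)$ is Scott open in $\mathcal O(X)$ and $V\in\sigma(L)$. *)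

(* Defs.v *)
From HB Require Import structures.
From mathcomp Require Import all_boot all_order.
From mathcomp Require Import all_classical topology.

Set Implicit Arguments.
Unset Strict Implicit.
Unset Printing Implicit Defensive.

Import Order.TTheory.
Local Open Scope classical_set_scope.
Local Open Scope order_scope.

Section dcpo.
Context {d : Order.disp_t} {P : porderType d}.
Implicit Types (x y z u s : P) (D A U : set P).

Definition directed D :=
  D !=set0 /\
  forall x y, D x -> D y -> exists z, [/\ D z, x <= z & y <= z].

Definition way_below u x :=
  forall D s, directed D -> supremums D s -> x <= s ->
    exists2 e, D e & u <= e.

Definition scott_open U :=
  (forall x y, U x -> x <= y -> U y) /\
  (forall D s, directed D -> supremums D s -> U s -> exists2 e, D e & U e).

End dcpo.

Definition dcpo {d : Order.disp_t} (P : porderType d) :=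
  forall D : set P, directed D -> supremums D !=set0.

Definition continuous_dcpo {d : Order.disp_t} (P : porderType d) :=
  dcpo P /\
  forall x : P, directed [set u | way_below u x] /\
                supremums [set u | way_below u x] x.

(* A may be empty: if P is nonempty, set0 has an upper bound, so P has a least
   element. *)
Definition bounded_complete {d : Order.disp_t} (P : porderType d) :=
  forall A : set P, ubound A !=set0 -> supremums A !=set0.

Section scott_open_topology.
Context {d : Order.disp_t} {P : porderType d}.

Lemma scott_openT : scott_open [set: P].
Proof. by split=> // D s [[e De] _] _ _; exists e. Qed.

Lemma scott_openI : setI_closed (@scott_open d P).
Proof.
move=> U V [Uup UD] [Vup VD]; split=> [x y [Ux Vx] xy|D s dD sD [Us Vs]].
  by split; [exact: Uup xy|exact: Vup xy].
have [e De Ue] := UD _ _ dD sD Us; have [f Df Vf] := VD _ _ dD sD Vs.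
have [g [Dg eg fg]] := dD.2 _ _ De Df.
by exists g => //; split; [exact: Uup eg|exact: Vup fg].
Qed.

Lemma scott_open_bigcup (I : Type) (U : I -> set P) :
  (forall i, scott_open (U i)) -> scott_open (\bigcup_i U i).
Proof.
move=> oU; split=> [x y [i _ Uix] xy|D s dD sD [i _ Uis]].
  by exists i => //; exact: (oU i).1 xy.
by have [e De Ue] := (oU i).2 _ _ dD sD Uis; exists e => //; exists i.
Qed.

End scott_open_topology.

(* An alias of P carrying its Scott topology, so that the library's continuity
   and generated topologies apply; the order of P is kept. *)
Definition scott_topology {d : Order.disp_t} (P : porderType d) : Type := P.

HB.instance Definition _ (d : Order.disp_t) (P : porderType d) :=
  Order.POrder.on (scott_topology P).
HB.instance Definition _ (d : Order.disp_t) (P : porderType d) :=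
  @isOpenTopological.Build (scott_topology P) (@scott_open d P)
    scott_openT scott_openI scott_open_bigcup.

Lemma scott_topologyE (d : Order.disp_t) (P : porderType d) :
  @open (scott_topology P) = @scott_open d P.
Proof. by []. Qed.

(* The lattice O(X), ordered by inclusion (see opens_leE). *)
Definition opens (X : topologicalType) : Type :=
  set_type [set U : set X | open U].

HB.instance Definition _ (X : topologicalType) := SubChoice.on (opens X).
HB.instance Definition _ (X : topologicalType) :=
  [SubChoice_isSubPOrder of opens X by <: with set_display].

Lemma opens_leE (X : topologicalType) (U V : opens X) :
  (U <= V) = (val U `<=` val V) :> Prop.
Proof. by rewrite -subsetEset. Qed.

Definition core_compact (X : topologicalType) := continuous_dcpo (opens X).

(* C(X, L), ordered pointwise (see scott_maps_leP). *)
Definition scott_maps (X : topologicalType) {d : Order.disp_t}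
    (L : porderType d) : Type :=
  continuousType X (scott_topology L).

Section scott_maps.
Context (X : topologicalType) {d : Order.disp_t} (L : porderType d).
Local Notation C := (scott_maps X L).

HB.instance Definition _ := Choice.on C.

Definition scott_maps_le (f g : C) : bool := `[< forall x, f x <= g x >].

Fact scott_maps_le_refl : reflexive scott_maps_le.
Proof. by move=> f; apply/asboolP. Qed.

Fact scott_maps_le_anti : antisymmetric scott_maps_le.
Proof.
move=> f g /andP[/asboolP fg /asboolP gf]; apply/continuousEP => x.
by apply/le_anti; rewrite fg gf.
Qed.

Fact scott_maps_le_trans : transitive scott_maps_le.
Proof.
move=> g f h /asboolP fg /asboolP gh; apply/asboolP => x.
exact: le_trans (fg x) (gh x).
Qed.

HB.instance Definition _ := Order.Le_isPOrder.Build FunOrder.fun_display C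
  scott_maps_le_refl scott_maps_le_anti scott_maps_le_trans.

Lemma scott_maps_leP (f g : C) : reflect (forall x, f x <= g x) (f <= g).
Proof. exact: asboolP. Qed.

Lemma open_scott_maps_preimage (f : C) (V : opens (scott_topology L)) :
  (f : X -> scott_topology L) @^-1` val V \in [set U : set X | open U].
Proof.
by apply/mem_set/open_comp => [x _|]; [exact: cts_fun|exact: set_valP].
Qed.

Definition opens_preimage (f : C) (V : opens (scott_topology L)) : opens X :=
  Sub (_ : set X) (open_scott_maps_preimage f V).

(* The sets [H, V] = {f | f^-1(V) is in H}, with H and V Scott open in O(X)
   and L. *)
Definition isbell_subbase : set_system C :=
  [set W | exists (H : opens (scott_topology (opens X)))
                  (V : opens (scott_topology L)),
             W = [set f | val H (opens_preimage f V)]].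

Definition isbell_topology : Type := C.

HB.instance Definition _ := Choice.on isbell_topology.
HB.instance Definition _ :=
  isSubBaseTopological.Build isbell_topology isbell_subbase id.

Lemma isbell_topologyE :
  @open isbell_topology =
  [set \bigcup_(B in D) B | D in [set D | D `<=` finI_from isbell_subbase id]].
Proof. by []. Qed.

End scott_maps.

(* Main.v *)
From HB Require Import structures.
Require Import Defs.
From mathcomp Require Import all_boot all_order finmap.
From mathcomp Require Import all_classical wochoice topology.

(** The Isbell topology is always contained in the Scott topology, since
directed suprema in C(X, L) are pointwise.

If L is bounded complete, a continuous f is the directed supremum of the
step functions [sup of the u_i with x in U_i], where (U_i, u_i) runs over
finite families with U_i << f^-1(way-above u_i).  A Scott open W containing f
contains one of them, and then contains the Isbell neighbourhood of f given
by the conditions U_i << h^-1(way-above u_i)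
([scott_open_isbell_open]).

Conversely, assume the two topologies always coincide, and write
N(l) = [bounds l] and M(l) = [way_bounds l] for the elements above, resp. way
above, all entries of a finite list l.  Say that l' approximates l when every
entry of l is way below an entry of l'; then N(l') is included in M(l).  The
heart of the proof is that N(l'), if nonempty, has a lower bound in M(l)
([bounds_lower_bound]).  Granting this, let A be a bounded set.  For lists l of
elements way below elements of A, the lower bounds so obtained form a directed
set, and its supremum is the supremum of A.

The lower bound is found by testing the hypothesis on spaces with an
Alexandrov topology, where an Isbell open set containing f contains all maps
agreeing with f at finitely many points.  The test space is a discrete set T
above a copy of the points of l'.  The Scott open condition that the images of
the latter be way above the entries of l confines the values on T to M(l), and
any element of N(l') is a possible value on T.
- If k and w in N(l') had no common lower bound in M(l), take T infinite.  Maps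
  taking on T only values below k form, together with the maps with some value
  neither below k nor below w, a Scott open set that no finite set of points
  can detect ([pair_lower_bound]).
- Let J be well-ordered without last element, and suppose that its proper
  initial segments have lower bounds in N(l') below some fixed v in N(l').  Take
  for T the power set of L.  Consider the maps h such that for each large c in
  J, there are two subsets with the same elements before c but different traces
  on J, at which the values of h are not lower bounds of the elements of J
  before c.  They form a Scott open set, inaccessibility being a Cantor diagonal
  argument.  If J had no lower bound in M(l), the map with constant value v on T
  would be in this set, but finitely many points could not detect it
  ([chain_lower_bound]).
Well-ordering N(l') and interpolating lists between l and l', these two cases
produce lower bounds of all initial segments of N(l') by induction. *)

Set Implicit Arguments.
Unset Strict Implicit.
Unset Printing Implicit Defensive.

Import Order.TTheory.
Local Open Scope classical_set_scope.
Local Open Scope order_scope.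

(** * Continuous dcpos *)

Section domain.
Context {d : Order.disp_t} {L : porderType d}.
Implicit Types (x y u v : L) (D : set L).

(** Finitely many conditions that each hold eventually along a directed set hold
simultaneously at one of its elements. *)
Lemma directed_forall (T : eqType) D (P : T -> L -> Prop) (s : seq T) :
    directed D ->
    (forall t a b, t \in s -> P t a -> a <= b -> P t b) ->
    (forall t, t \in s -> exists2 e, D e & P t e) ->
  exists2 e, D e & forall t, t \in s -> P t e.
Proof.
move=> [[e0 De0] dD]; elim: s => [|t s IHs] Pup Ps; first by exists e0.
have [t1 a b t1s|t1 t1s|e De Pe] := IHs.
- by apply: Pup; rewrite inE t1s orbT.
- by apply: Ps; rewrite inE t1s orbT.
have [e' De' Pe'] := Ps t (mem_head _ _).
have [z [Dz ez e'z]] := dD _ _ De De'.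
exists z => // t1; rewrite inE => /orP[/eqP ->|t1s].
  by apply: Pup Pe' e'z; exact: mem_head.
by apply: Pup (Pe _ t1s) ez; rewrite inE t1s orbT.
Qed.

Lemma way_belowW u x : way_below u x -> u <= x.
Proof.
have dx : directed [set x].
  by split=> [|_ _ -> ->]; [exists x|exists x].
move=> /(_ [set x] x dx)[]//; first by rewrite supremums1.
by move=> _ ->.
Qed.

Lemma le_way_below_trans u v x : u <= v -> way_below v x -> way_below u x.
Proof.
move=> uv vx D s dD sD xs; have [e De ve] := vx _ _ dD sD xs.
by exists e => //; exact: le_trans uv ve.
Qed.

Lemma way_below_le_trans u v x : way_below u v -> v <= x -> way_below u x.
Proof. by move=> uv vx D s dD sD xs; apply: uv dD sD (le_trans vx xs). Qed.

Lemma scott_open_notle y : scott_open [set x | ~ x <= y].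
Proof.
split=> [x z /= xy xz zy|D s dD [_ sl] /= sy]; first exact/xy/(le_trans xz).
apply: contrapT => De; apply/sy/sl => e eD; apply: contrapT => ey.
by apply: De; exists e.
Qed.

Hypothesis Lc : continuous_dcpo L.

Lemma way_below_lub x b : (forall u, way_below u x -> u <= b) -> x <= b.
Proof. by move=> xb; apply: (Lc.2 x).2.2. Qed.

Lemma way_below_interpolation u x :
  way_below u x -> exists2 v, way_below u v & way_below v x.
Proof.
(* x is the directed supremum of the elements two steps way below it. *)
pose D := [set w | exists2 v, way_below w v & way_below v x].
have dD : directed D.
  split=> [|w1 w2 [v1 w1v1 v1x] [v2 w2v2 v2x]].
    have [v vx] := (Lc.2 x).1.1; have [w wv] := (Lc.2 v).1.1.
    by exists w, v.
  have [v [vx v1v v2v]] := (Lc.2 x).1.2 _ _ v1x v2x.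
  have [w [wv w1w w2w]] := (Lc.2 v).1.2 _ _
    (way_below_le_trans w1v1 v1v) (way_below_le_trans w2v2 v2v).
  by exists w; split=> //; exists v.
have sD : supremums D x.
  split=> [w [v wv vx]|b Db].
    exact: le_trans (way_belowW wv) (way_belowW vx).
  by apply: way_below_lub => v vx; apply: way_below_lub => w wv;
    apply: Db; exists v.
move=> ux; have [w [v wv vx] uw] := ux _ _ dD sD (lexx x).
by exists v => //; exact: le_way_below_trans wv.
Qed.

Lemma scott_open_way_above u : scott_open [set x | way_below u x].
Proof.
split=> [x y /=|D s dD sD /= us]; first exact: way_below_le_trans.
have [v uv vs] := way_below_interpolation us.
have [e De ve] := vs _ _ dD sD (lexx s).
by exists e => //; exact: way_below_le_trans ve.
Qed.

End domain.

(** * Lattices of open sets *)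

Section opens.
Context {X : topologicalType}.
Implicit Types (U V : opens X) (D : set (opens X)).

Definition to_opens (U : set X) (oU : open U) : opens X := exist _ U (mem_set oU).

Lemma opensP U : open (val U).
Proof. exact: set_valP. Qed.

Lemma open_of_local (A : set X) :
    (forall x, A x -> exists2 O, open O & O x /\ O `<=` A) ->
  open A.
Proof.
move=> Aloc; rewrite openE => x /Aloc[O oO [Ox OA]].
by apply: (filterS OA); exact: open_nbhs_nbhs.
Qed.

Lemma opens_sup D U : supremums D U <-> val U = \bigcup_(V in D) val V.
Proof.
have oD : open (\bigcup_(V in D) val V).
  by apply: bigcup_open => V _; exact: opensP.
have ubD (V : opens X) : ubound D V <-> \bigcup_(V in D) val V `<=` val V.
  split=> [DV x [W DW Wx]|DV W DW]; last first.
    by rewrite opens_leE => x Wx; apply: DV; exists W.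
  by have := DV _ DW; rewrite opens_leE; exact.
split=> [[/ubD DU Ul]|UD]; last first.
  split; first by apply/ubD; rewrite UD.
  by move=> V /ubD DV; rewrite opens_leE UD.
apply/seteqP; split=> //; have := Ul (to_opens oD).
by rewrite opens_leE; apply; apply/ubD.
Qed.

Lemma opens_sup_mem D U x :
  supremums D U -> val U x -> exists2 V, D V & val V x.
Proof. by move=> /opens_sup ->; case=> V DV Vx; exists V. Qed.

Lemma opens_dcpo : dcpo (opens X).
Proof.
move=> D _; have oD : open (\bigcup_(V in D) val V).
  by apply: bigcup_open => V _; exact: opensP.
by exists (to_opens oD); apply/opens_sup.
Qed.

End opens.

(** * Continuous maps and the Isbell topology *)

Section maps.
Context {X : topologicalType} {d : Order.disp_t} {L : porderType d}.
Local Notation C := (scott_maps X L).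
Implicit Types (f g s : C) (D W : set C).

Lemma scott_map_exists (f : X -> L) :
    (forall V : set L, scott_open V -> open (f @^-1` V)) ->
  exists g : C, forall x, g x = f x.
Proof.
move=> fV; have cf : continuous (f : X -> scott_topology L).
  by apply/continuousP => V oV; exact: fV.
pose g := HB.pack_for (continuousType X (scott_topology L))
  (f : X -> scott_topology L) (isContinuous.Build _ _ _ cf).
by exists g.
Qed.

Lemma open_preimage_scott f (V : set L) : scott_open V -> open (f @^-1` V).
Proof. by move=> oV; apply: open_comp => // x _; exact: cts_fun. Qed.

(** The supremum s is only assumed to be a least upper bound in C(X, L).  It is
the pointwise supremum because the latter is continuous. *)
Lemma scott_maps_sup_mem D s x (V : set L) : dcpo L ->
    directed D -> supremums D s -> scott_open V -> V (s x) ->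
  exists2 f, D f & V (f x).
Proof.
move=> Ld dD [Ds sl] oV Vsx.
have dDy y : directed [set (f y : L) | f in D].
  split; first by have [f Df] := dD.1; exists (f y), f.
  move=> _ _ [f Df <-] [g Dg <-]; have [h [Dh fh gh]] := dD.2 _ _ Df Dg.
  exists (h y); split; first by exists h.
    exact: (scott_maps_leP _ _ fh).
  exact: (scott_maps_leP _ _ gh).
have [t tP] : {t : X -> L &
    forall y, supremums [set (f y : L) | f in D] (t y)}.
  by apply: (@choice _ _ (fun y => supremums [set (f y : L) | f in D])) => y; exact: Ld.
have tV (y : X) (U : set L) : scott_open U -> U (t y) -> exists2 f, D f & U (f y).
  move=> oU Uty; have [_ [f Df <-] Uf] := oU.2 _ _ (dDy y) (tP y) Uty.
  by exists f.
have [g gt] : exists g : C, forall y, g y = t y.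
  apply: scott_map_exists => U oU; apply: open_of_local => y /= /(tV _ _ oU)[f Df Uf].
  exists (f @^-1` U); first exact: open_preimage_scott.
  split=> // z /= Uz; apply: oU.1 Uz _.
  by apply: (tP z).1; exists f.
have /scott_maps_leP sg : s <= g.
  by apply: sl => f Df; apply/scott_maps_leP => y; rewrite gt;
    apply: (tP y).1; exists f.
by apply: tV => //; apply: oV.1 Vsx _; rewrite -gt; exact: sg.
Qed.

(** Neighbourhoods as finite lists of subbasic sets, so that statements on Isbell
open sets can be proved by induction on the list. *)
Lemma isbell_openP W :
  @open (isbell_topology X L) W <->
  forall f, W f -> exists2 B : seq (set C),
    (forall A, A \in B -> @isbell_subbase X d L A /\ A f) &
    (forall g, (forall A, A \in B -> A g) -> W g).
Proof.
rewrite isbell_topologyE; split.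
  move=> [F /= FI <-] f [A FA Af].
  have [E Esub EA] := FI _ FA.
  exists (E : seq _) => [A0 A0E|g gE].
    split; first by have /set_mem := Esub _ A0E.
    by move: Af; rewrite -EA; apply.
  by exists A => //; rewrite -EA => A0 A0E; exact: gE.
move=> Wloc; exists [set A | finI_from (@isbell_subbase X d L) id A /\ A `<=` W].
  by move=> A [].
apply/seteqP; split=> [g [A [_ AW]]|f /Wloc[B Bf BW]]; first exact: AW.
exists (\bigcap_(A in [set` [fset A | A in B]%fset]) A) => [|A /=].
  split; last first.
    by move=> g gB; apply: BW => A AB; apply: gB; rewrite /= !inE/=.
  exists [fset A | A in B]%fset => // A; rewrite !inE /= => AB.
  exact: (Bf _ AB).1.
by rewrite !inE => /Bf[].
Qed.

Lemma scott_open_isbell_subbase A : dcpo L ->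
  @isbell_subbase X d L A -> scott_open A.
Proof.
move=> Ld [H [V ->]]; have oH := opensP H; have oV := opensP V.
split=> [f g /= Hf fg|D s dD sD /= Hs].
  apply: oH.1 Hf _; rewrite opens_leE /= => x /= Vf.
  by apply: oV.1 Vf _; exact: (scott_maps_leP _ _ fg).
have dE : directed [set opens_preimage f V | f in D].
  split; first by have [f Df] := dD.1; exists (opens_preimage f V), f.
  move=> _ _ [f Df <-] [g Dg <-]; have [h [Dh fh gh]] := dD.2 _ _ Df Dg.
  exists (opens_preimage h V); split; first by exists h.
    rewrite opens_leE /= => x /= Vf.
    by apply: oV.1 Vf _; exact: (scott_maps_leP _ _ fh).
  rewrite opens_leE /= => x /= Vf.
  by apply: oV.1 Vf _; exact: (scott_maps_leP _ _ gh).
have sE : supremums [set opens_preimage f V | f in D] (opens_preimage s V).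
  apply/opens_sup/seteqP; split=> [x /= Vs|x [_ [f Df <-] /= Vf]].
    have [f Df Vf] := scott_maps_sup_mem Ld dD sD oV Vs.
    by exists (opens_preimage f V); [exists f|].
  by apply: oV.1 Vf _; exact/scott_maps_leP/sD.1.
by have [_ [f Df <-] Hf] := oH.2 _ _ dE sE Hs; exists f.
Qed.

Lemma isbell_open_scott_open W : dcpo L ->
  @open (isbell_topology X L) W -> scott_open W.
Proof.
move=> Ld /isbell_openP Wloc; split=> [f g /Wloc[B Bf BW] fg|D s dD sD].
  by apply: BW => A /Bf[/(scott_open_isbell_subbase Ld) oA Af]; exact: oA.1 fg.
move=> /Wloc[B Bs BW].
have [|A /Bs[/(scott_open_isbell_subbase Ld) oA As]|f Df fB] :=
    @directed_forall _ _ _ D (fun A : set C => A) B dD.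
- by move=> A f g /Bs[/(scott_open_isbell_subbase Ld) oA As]; exact: oA.1.
- by have [f Df Af] := oA.2 _ _ dD sD As; exists f.
- by exists f => //; exact: BW.
Qed.

End maps.

(** * Bounded complete domains: approximation by step functions *)

Section step_functions.
Context {X : topologicalType} {d : Order.disp_t} {L : porderType d}.
Local Notation C := (scott_maps X L).
Implicit Types (f g h : C) (F : seq (opens X * L)).

Definition step_values F (x : X) : set L :=
  [set u | exists2 U : opens X, (U, u) \in F & val U x].

Lemma open_step_support F x :
  exists2 O, open O & O x /\ forall y, O y -> step_values F x `<=` step_values F y.
Proof.
suff [O oO [Ox OF]] : exists2 O, open O & O x /\ forall y, O y ->
    forall U u, (U, u) \in F -> val U x -> val U y.
  exists O => //; split=> // y Oy u [U UF Ux]; exists U => //.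
  exact: OF UF Ux.
elim: F => [|[U u] F [O oO [Ox OF]]]; first by exists setT; [exact: openT|].
have [Ux|nUx] := EM (val U x).
  exists (O `&` val U); first by apply: openI => //; exact: opensP.
  split=> // y [Oy Uy] V v; rewrite inE => /orP[/eqP[-> _]//|].
  exact: OF.
exists O => //; split=> // y Oy V v; rewrite inE => /orP[/eqP[-> _]//|].
exact: OF.
Qed.

(** The supremum of the values attached to x can only grow near x, because x has
a neighbourhood inside the finitely many open sets containing it.  The map f
serves as a bound for the values. *)
Lemma step_map_exists f F : bounded_complete L ->
    (forall x, ubound (step_values F x) (f x)) ->
  exists g, forall x, supremums (step_values F x) (g x).
Proof.
move=> bcL Ff; have [t tP] : {t : X -> L &
    forall x, supremums (step_values F x) (t x)}.
  apply: (@choice _ _ (fun x => supremums (step_values F x))) => x.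
  by apply: bcL; exists (f x).
have [g gt] : exists g : C, forall x, g x = t x.
  apply: scott_map_exists => V oV; apply: open_of_local => x /= Vtx.
  have [O oO [Ox OF]] := open_step_support F x.
  exists O => //; split=> // y Oy /=; apply: oV.1 Vtx _.
  by apply: (tP x).2 => u /(OF y Oy); exact: (tP y).1.
by exists g => x; rewrite gt.
Qed.

Hypothesis Lc : continuous_dcpo L.

Definition way_above_preimage f u : opens X :=
  to_opens (open_preimage_scott f (scott_open_way_above Lc u)).

(** Step functions below f are given by lists F of pairs (U, u) satisfying the
Isbell open condition U << f^-1(way-above u); any h satisfying the same
conditions is above the step function of F. *)
Lemma scott_open_isbell_open (W : set C) :
  core_compact X -> bounded_complete L -> scott_open W ->
  @open (isbell_topology X L) W.
Proof.
move=> Xc bcL oW; apply/isbell_openP => f Wf.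
pose below F := forall p, p \in F -> way_below p.1 (way_above_preimage f p.2).
have ub_below F g : (forall p, p \in F -> way_below p.1 (way_above_preimage g p.2)) ->
    forall x, ubound (step_values F x) (g x).
  move=> Fg x u [U UF Ux]; have := way_belowW (Fg _ UF).
  by rewrite opens_leE => /(_ x Ux) /way_belowW.
pose D : set C := [set g : C | exists2 F, below F &
  forall x, supremums (step_values F x) (g x)].
have step F : below F -> exists2 g : C, D g & forall x, supremums (step_values F x) (g x).
  move=> Fb; have [g gF] := step_map_exists bcL (ub_below _ _ Fb).
  by exists g => //; exists F.
have dD : directed D.
  split=> [|g1 g2 [F1 F1b g1F] [F2 F2b g2F]].
    by have [//|g Dg _] := step [::]; exists g.
  have [|g Dg gF] := step (F1 ++ F2).
    by move=> p; rewrite mem_cat => /orP[/F1b|/F2b].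
  exists g; split=> //; apply/scott_maps_leP => x.
    by apply: (g1F x).2 => u [U UF Ux]; apply: (gF x).1; exists U;
      rewrite // mem_cat UF.
  by apply: (g2F x).2 => u [U UF Ux]; apply: (gF x).1; exists U;
    rewrite // mem_cat UF orbT.
have sD : supremums D f.
  split=> [g [F Fb gF]|b Db]; apply/scott_maps_leP => x.
    by apply: (gF x).2; exact: ub_below.
  apply: (way_below_lub Lc) => u ux.
  have [U Ub Ux] := opens_sup_mem (Xc.2 (way_above_preimage f u)).2 ux.
  have [|g Dg gF] := step [:: (U, u)].
    by move=> p; rewrite inE => /eqP ->.
  apply: le_trans (scott_maps_leP _ _ (Db _ Dg) x).
  by apply: (gF x).1; exists U; rewrite // inE.
have [g [F Fb gF] Wg] := oW.2 _ _ dD sD Wf.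
exists [seq [set h | way_below p.1 (way_above_preimage h p.2)] | p <- F].
  move=> A /mapP[p pF ->]; split; last exact: Fb.
  exists (to_opens (X := scott_topology (opens X)) (scott_open_way_above Xc p.1)).
  exists (to_opens (X := scott_topology L) (scott_open_way_above Lc p.2)).
  by apply/seteqP; split=> h /=; congr (way_below _ _); exact: val_inj.
move=> h hF; apply: oW.1 Wg _; apply/scott_maps_leP => x.
apply: (gF x).2; apply: ub_below => p pF.
exact: (hF _ (map_f _ pF)).
Qed.

End step_functions.

(** * Alexandrov spaces *)

(** The relation R need not be a preorder: the topology is that of the preorder
it generates. *)
Definition alexandrov (T : Type) (R : T -> T -> Prop) : Type := T.

Section alexandrov_topology.
Variables (T : Type) (R : T -> T -> Prop).

Definition alexandrov_open (U : set (alexandrov R)) :=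
  forall x y, R x y -> U x -> U y.

Lemma alexandrov_openT : alexandrov_open setT.
Proof. by []. Qed.

Lemma alexandrov_openI : setI_closed alexandrov_open.
Proof. by move=> U V oU oV x y Rxy [Ux Vx]; split; [exact: oU Ux|exact: oV Vx]. Qed.

Lemma alexandrov_open_bigcup (I : Type) (U : I -> set (alexandrov R)) :
  (forall i, alexandrov_open (U i)) -> alexandrov_open (\bigcup_i U i).
Proof. by move=> oU x y Rxy [i _ Ux]; exists i => //; exact: oU Ux. Qed.

HB.instance Definition _ := gen_eqMixin (alexandrov R).
HB.instance Definition _ := gen_choiceMixin (alexandrov R).
HB.instance Definition _ := @isOpenTopological.Build (alexandrov R)
  alexandrov_open alexandrov_openT alexandrov_openI alexandrov_open_bigcup.

Lemma alexandrov_openE : @open (alexandrov R) = alexandrov_open.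
Proof. by []. Qed.

End alexandrov_topology.

Section alexandrov_theory.
Context {T : Type} {R : T -> T -> Prop}.
Local Notation X := (alexandrov R).
Implicit Types (s : seq X) (U V : opens X).

Lemma open_hull (A : set X) :
  open [set x : X | forall U, A `<=` val U -> val U x].
Proof. by move=> x y Rxy Ax U AU; apply: (opensP U) Rxy _; exact: Ax. Qed.

(** The smallest open set containing the entries of s; these are the compact open
sets, which generate the lattice of open sets. *)
Definition hull s : opens X := to_opens (@open_hull [set` s]).

Lemma hull_le s U : (forall x, x \in s -> val U x) -> hull s <= U.
Proof. by move=> sU; rewrite opens_leE => x; apply; exact: sU. Qed.

Lemma hullS s1 s2 : {subset s1 <= s2} -> hull s1 <= hull s2.
Proof. by move=> s12; apply: hull_le => x /s12 xs2 U; exact. Qed.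

Lemma hull_catl s1 s2 : hull s1 <= hull (s1 ++ s2).
Proof. by apply: hullS => x; rewrite mem_cat => ->. Qed.

Lemma hull_catr s1 s2 : hull s2 <= hull (s1 ++ s2).
Proof. by apply: hullS => x; rewrite mem_cat orbC => ->. Qed.

Lemma hull_directed_sup U :
  directed [set hull s | s in [set s : seq X | [set` s] `<=` val U]] /\
  supremums [set hull s | s in [set s : seq X | [set` s] `<=` val U]] U.
Proof.
split.
  split; first by exists (hull [::]), [::].
  move=> _ _ [s1 s1U <-] [s2 s2U <-].
  exists (hull (s1 ++ s2)); split; [|exact: hull_catl|exact: hull_catr].
  by exists (s1 ++ s2) => // x /=; rewrite mem_cat => /orP[/s1U|/s2U].
split=> [_ [s sU <-]|V hV]; first exact: hull_le.
rewrite opens_leE => x Ux.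
have xU : [set` [:: x]] `<=` val U by move=> y /=; rewrite inE => /eqP ->.
have /(_ x) : val (hull [:: x]) `<=` val V.
  by rewrite -opens_leE; apply: hV; exists [:: x].
by apply=> W; apply; rewrite /= inE.
Qed.

Lemma hull_way_below s U : [set` s] `<=` val U -> way_below (hull s) U.
Proof.
move=> sU D V dD sD; rewrite opens_leE => UV.
have [t A B _|x /sU/UV Vx|W DW Ws] :=
    @directed_forall _ _ _ D (fun (x : X) (A : opens X) => val A x) s dD.
- by rewrite opens_leE => tA; apply.
- exact: opens_sup_mem sD Vx.
- by exists W => //; exact: hull_le.
Qed.

Lemma way_below_hull U V :
  way_below V U -> exists2 s : seq X, [set` s] `<=` val U & V <= hull s.
Proof.
have [dU sU] := hull_directed_sup U.
by move=> /(_ _ _ dU sU (lexx U))[_ [s s_U <-]]; exists s.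
Qed.

Lemma core_compact_alexandrov : core_compact X.
Proof.
split=> [|U]; first exact: opens_dcpo.
split; [split|].
- by exists (hull [::]); exact: hull_way_below.
- move=> V1 V2 /way_below_hull[s1 s1U V1s] /way_below_hull[s2 s2U V2s].
  exists (hull (s1 ++ s2)); split.
  + by apply: hull_way_below => x /=; rewrite mem_cat => /orP[/s1U|/s2U].
  + exact: le_trans (hull_catl _ _).
  + exact: le_trans (hull_catr _ _).
- split=> [V /way_belowW//|V UV].
  by apply: (hull_directed_sup U).2.2 => _ [s sU <-]; apply: UV; exact: hull_way_below.
Qed.

Context {d : Order.disp_t} {L : porderType d}.
Local Notation C := (scott_maps X L).

Lemma alexandrov_map_exists (f : T -> L) :
  (forall x y, R x y -> f x <= f y) -> exists g : C, forall x, g x = f x.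
Proof.
move=> fR; apply: scott_map_exists => V oV.
by rewrite alexandrov_openE => x y /fR fxy Vx; exact: oV.1 Vx fxy.
Qed.

(** The complement of the principal ideal of g y is Scott open, so its preimage
is closed under R. *)
Lemma alexandrov_map_mono (g : C) x y : R x y -> g x <= g y.
Proof.
move=> Rxy; apply: contrapT => gxy.
have := open_preimage_scott g (scott_open_notle (g y)).
by rewrite alexandrov_openE => /(_ x y Rxy gxy); apply.
Qed.

(** If f^-1(V) belongs to a Scott open H, then so does the hull of finitely many
points of f^-1(V); any g agreeing with f at these points has this hull
inside g^-1(V). *)
Lemma isbell_open_finitely_determined (W : set C) f :
  @open (isbell_topology X L) W -> W f ->
  exists F : seq X, forall g : C, {in F, forall x, g x = f x} -> W g.
Proof.
move=> /isbell_openP Wloc /Wloc[B Bf BW].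
have {BW}: forall g : C, (forall A, A \in B -> A g) -> W g by [].
elim: B W {Wloc} Bf => [|A B IHB] W Bf BW; first by exists [::] => g _; exact: BW.
have [|F BF] := IHB [set g | forall A, A \in B -> A g] _ (fun g Bg => Bg).
  by move=> A0 A0B; apply: Bf; rewrite inE A0B orbT.
have [[H [V AE]] Af] := Bf A (mem_head _ _).
have [s sf Hs] : exists2 s : seq X,
    [set` s] `<=` val (opens_preimage f V) & val H (hull s).
  have [dV sV] := hull_directed_sup (opens_preimage f V).
  have HV : val H (opens_preimage f V) by rewrite AE in Af.
  by have [_ [s sf <-] Hs] := (opensP H).2 _ _ dV sV HV; exists s.
exists (s ++ F) => g gf; apply: BW => A0; rewrite inE => /orP[/eqP->|]; last first.
  by apply: BF => x xF; apply: gf; rewrite mem_cat xF orbT.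
rewrite AE /=; apply: (opensP H).1 Hs _; apply: hull_le => x xs /=.
by rewrite gf ?mem_cat ?xs //; exact: sf.
Qed.

End alexandrov_theory.

(** Inaccessibility of W only has to be tested on directed sets inside the open
set O: a directed set with supremum in O has a cofinal part in O. *)
Lemma scott_open_relative {d : Order.disp_t} {P : porderType d} (O W : set P) :
    scott_open O ->
    (forall x y, W x -> x <= y -> W y) ->
    (forall D s, directed D -> D `<=` O -> supremums D s -> W s ->
      exists2 e, D e & W e) ->
  scott_open (O `&` W).
Proof.
move=> oO Wup WD; split=> [x y [Ox Wx] xy|D s dD sD [Os Ws]].
  by split; [exact: oO.1 Ox xy|exact: Wup xy].
have [e De Oe] := oO.2 _ _ dD sD Os.
pose D' := [set x | D x /\ e <= x].
have dD' : directed D'.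
  split=> [|x y [Dx ex] [Dy ey]]; first by exists e.
  have [z [Dz xz yz]] := dD.2 _ _ Dx Dy.
  by exists z; split=> //; split=> //; exact: le_trans xz.
have sD' : supremums D' s.
  split=> [x [Dx _]|b D'b]; first exact: sD.1.
  apply: sD.2 => x Dx; have [z [Dz xz ez]] := dD.2 _ _ Dx De.
  by apply: le_trans xz _; exact: D'b.
have [|x [Dx ex] Wx] := WD _ _ dD' _ sD' Ws.
  by move=> x [_ ex]; exact: oO.1 ex.
by exists x => //; split=> //; exact: oO.1 ex.
Qed.

(** * Well-orders and diagonalization *)

Lemma well_founded_order (T : eqType) : exists lt : T -> T -> Prop,
  [/\ well_founded lt, forall x y z, lt x y -> lt y z -> lt x z &
      forall x y, [\/ x = y, lt x y | lt y x]].
Proof.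
have [R wR] := well_ordering_principle T.
have minR (A : {pred T}) x : x \in A ->
    exists2 y, y \in A & forall z, z \in A -> R y z.
  move=> Ax; have [|y [[Ay yA] _]] := wR A; first by exists x.
  by exists y.
have [[[Rxx Rtr] Ranti] Rtot] : total_order R.
  have cR : wo_chain R predT by move=> A _; exact: wR.
  split; last by move=> x y; exact: (wo_chainW cR).
  have Ranti : antisymmetric R.
    by move=> x y; apply: (wo_chain_antisymmetric cR).
  split=> //; split=> [x|y x z Rxy Ryz].
    exact: (wo_chain_reflexive cR).
  (* Transitivity comes from the least element of {x, y, z}. *)
  have [w] := minR [pred t | t \in [:: x; y; z]] x (mem_head _ _).
  rewrite !inE => /or3P[]/eqP -> wmin.
  - by apply: wmin; rewrite !inE eqxx !orbT.
  - have Ryx : R y x by apply: wmin; rewrite !inE eqxx.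
    by rewrite (Ranti x y) ?Rxy ?Ryx.
  - have Rzy : R z y by apply: wmin; rewrite !inE eqxx !orbT.
    by rewrite -(Ranti y z) ?Rzy ?Ryz.
exists (fun x y => R x y /\ x != y); split.
- move=> x; apply: contrapT => nx.
  have [y] := minR [pred t | `[< ~ Acc (fun x y => R x y /\ x != y) t >]] x (asboolT nx).
  move=> /asboolP-ny ymin; apply: ny; constructor=> z [Rzy zy].
  apply: contrapT => nz; move/eqP: zy; apply; apply: Ranti.
  by rewrite Rzy; apply: ymin; apply/asboolP.
- move=> x y z [Rxy xy] [Ryz yz]; split; first exact: Rtr Ryz.
  apply/eqP => xz; subst z; move/eqP: xy; apply; apply: Ranti.
  by rewrite Rxy Ryz.
- move=> x y; have [->|xy] := eqVneq x y; first by constructor.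
  have /orP[Rxy|Ryx] := Rtot x y; first by constructor 2.
  by constructor 3; split=> //; rewrite eq_sym.
Qed.

Section well_founded.
Context {T : Type} {lt : T -> T -> Prop}.
Hypothesis lt_wf : well_founded lt.

Lemma wf_least (A : set T) : A !=set0 ->
  exists2 x, A x & forall y, lt y x -> ~ A y.
Proof.
move=> [x]; elim/(well_founded_ind lt_wf): x => x IHx Ax.
have [[y yx Ay]|nx] := EM (exists2 y, lt y x & A y); first exact: IHx Ay.
by exists x => // y yx Ay; apply: nx; exists y.
Qed.

(** Cantor's diagonal set: if x itself satisfies P at c, and P at c holds of at
most one set with given elements below c, then c can neither be nor not be in
x. *)
Lemma wf_diagonal (P : set T -> T -> Prop) : exists x : set T, forall c,
  x c <-> ~ exists y : set T, [/\ P y c, forall b, lt b c -> (y b <-> x b) & y c].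
Proof.
pose step c (rec : forall b, lt b c -> Prop) : Prop :=
  ~ exists y : set T, [/\ P y c, forall b (bc : lt b c), y b <-> rec b bc & y c].
exists (Fix lt_wf (fun=> Prop) step) => c.
rewrite Fix_eq // => {}c f g fg; congr step.
by apply: functional_extensionality_dep => b; apply: functional_extensionality_dep.
Qed.

End well_founded.

(** * The test spaces *)

Section fan.
Context {d : Order.disp_t} {L : porderType d}.

(** The Alexandrov space of this relation is a discrete set T placed above the
points inr a for a in l'.  The points inr a for other a are isolated; having all
of L as right summand avoids a subtype. *)
Definition fan_rel (T : Type) (l' : seq L) (x y : T + L) : Prop :=
  if (x, y) is (inr a, inl _) then a \in l' else False.

Definition bounds (l : seq L) : set L := [set m | forall a, a \in l -> a <= m].

Definition way_bounds (l : seq L) : set L :=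
  [set m | forall u, u \in l -> way_below u m].

Definition approximates (l l' : seq L) :=
  forall u, u \in l -> exists2 a, a \in l' & way_below u a.

Lemma approximates_bounds l l' : approximates l l' -> bounds l' `<=` way_bounds l.
Proof.
by move=> ll' m ml' u /ll'[a al' ua]; apply: way_below_le_trans ua (ml' _ al').
Qed.

Hypothesis Lc : continuous_dcpo L.

Section test_space.
Variables (T : Type) (l l' : seq L).
Hypothesis ll' : approximates l l'.
Local Notation X := (alexandrov (@fan_rel T l')).
Local Notation C := (scott_maps X L).

(** The entries of l' are the values at the points inr a of the maps considered
below; only the entries of l can be forced by a Scott open condition. *)
Definition pinned : set C :=
  [set h | forall u, u \in l ->
    exists2 a, a \in l' & way_below u (h (inr a))].

Lemma scott_open_pinned : scott_open pinned.
Proof.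
split=> [f g /= fl fg u ul|D s dD sD /= sl].
  have [a al' ua] := fl u ul; exists a => //.
  exact: way_below_le_trans ua (scott_maps_leP _ _ fg _).
apply: (@directed_forall _ _ _ D (fun (u : L) (f : C) =>
  exists2 a, a \in l' & way_below u (f (inr a))) l dD).
  move=> u f g _ [a al' ua] fg; exists a => //.
  exact: way_below_le_trans ua (scott_maps_leP _ _ fg _).
move=> u /sl[a al' ua].
have [f Df uf] := scott_maps_sup_mem Lc.1 dD sD (scott_open_way_above Lc u) ua.
by exists f => //; exists a.
Qed.

Lemma pinned_way_bounds h (x : T) : pinned h -> way_bounds l (h (inl x)).
Proof.
move=> hl u /hl[a al' ua]; apply: way_below_le_trans ua _.
exact: (@alexandrov_map_mono _ (@fan_rel T l') _ _ h (inr a) (inl x)).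
Qed.

Definition two_valued (p : T -> Prop) (v w : L) (h : C) : Prop :=
  [/\ forall a, h (inr a) = a, forall x, p x -> h (inl x) = v &
      forall x, ~ p x -> h (inl x) = w].

Lemma two_valued_exists p v w : bounds l' v -> bounds l' w ->
  exists h, two_valued p v w h.
Proof.
move=> vl' wl'; have [|h hE] := @alexandrov_map_exists _ (@fan_rel T l') _ L
    (fun y => match y with
      inl x => if `[< p x >] then v else w | inr a => a end).
  by move=> [x|a] [y|b] //=; case: asboolP => _; [exact: vl'|exact: wl'].
exists h; split=> [a|x px|x px]; rewrite hE //.
  by case: asboolP.
by case: asboolP.
Qed.

Lemma two_valued_pinned p v w h : two_valued p v w h -> pinned h.
Proof. by move=> [hr _ _] u /ll'[a al' ua]; exists a => //; rewrite hr. Qed.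

Hypothesis scott_isbell : @open (isbell_topology X L) = @open (scott_topology C).

(** Coincidence of the topologies in the form used below: a Scott open set
containing the map with constant value v on T still contains the map modified
to any w outside some finite subset of T. *)
Lemma scott_open_two_valued (W : set C) v :
    scott_open W -> (forall h, two_valued setT v v h -> W h) -> bounds l' v ->
  exists F : seq X, forall w, bounds l' w ->
    exists2 h, two_valued [set x | (inl x : X) \in F] v w h & W h.
Proof.
move=> oW Wv vl'; have [f fv] := two_valued_exists setT vl' vl'; have [fr fl _] := fv.
have oW' : @open (isbell_topology X L) W by rewrite scott_isbell.
have [F FW] := isbell_open_finitely_determined oW' (Wv _ fv).
exists F => w wl'.
have [h hF] := two_valued_exists [set x | (inl x : X) \in F] vl' wl'.
have [hr hl _] := hF.
by exists h => //; apply: FW => -[x|a] xF; [rewrite hl // fl|rewrite hr fr].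
Qed.

End test_space.
End fan.

(** * Lower bounds of sets of upper bounds *)

Section lower_bounds.
Context {d : Order.disp_t} {L : porderType d}.
Implicit Types (l : seq L) (J : set L).
Hypothesis Lc : continuous_dcpo L.
Hypothesis scott_isbell : forall X : topologicalType, core_compact X ->
  @open (isbell_topology X L) = @open (scott_topology (scott_maps X L)).

(** Without a common lower bound, a pinned map below k has no value below w, so a
map whose values are all below k cannot be approached from below by maps outside
W.  But the map equal to k on a finite set F and to w elsewhere is not in W. *)
Lemma pair_lower_bound l l' k w : approximates l l' ->
    bounds l' k -> bounds l' w ->
  exists m, [/\ way_bounds l m, m <= k & m <= w].
Proof.
move=> ll' kl' wl'; apply: contrapT => nlb.
pose C := scott_maps (alexandrov (@fan_rel _ L nat l')) L.
pose W : set C := [set h |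
  (exists2 x : nat, ~ h (inl x) <= k & ~ h (inl x) <= w) \/
  forall x : nat, ~ h (inl x) <= w].
have oW : scott_open (@pinned _ L nat l l' `&` W).
  apply: scott_open_relative.
  - exact: scott_open_pinned.
  - move=> f g fW /scott_maps_leP fg; case: fW => [[x fk fw]|fw]; [left|right].
      by exists x => [/(le_trans (fg _))|/(le_trans (fg _))].
    by move=> x /(le_trans (fg _)); exact: fw.
  - move=> D s dD Dl sD Ws.
    have [[x sk sw]|nV] := EM (exists2 x : nat, ~ s (inl x) <= k & ~ s (inl x) <= w).
      have [f Df [fk fw]] := scott_maps_sup_mem Lc.1 dD sD
        (scott_openI (scott_open_notle k) (scott_open_notle w)) (conj sk sw).
      by exists f => //; left; exists x.
    have [f Df] := dD.1; exists f => //; right=> x fw.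
    have fs : f (inl x) <= s (inl x) by exact/scott_maps_leP/sD.1.
    apply: nlb; exists (f (inl x)); split=> //.
      exact: pinned_way_bounds (Dl _ Df).
    apply: le_trans fs _; apply: contrapT => sk.
    by case: Ws => [//|/(_ x) sw]; apply: nV; exists x.
have [|F] := scott_open_two_valued
    (scott_isbell (core_compact_alexandrov (R := @fan_rel _ L nat l'))) oW _ kl'.
  move=> h hk; split; first exact: two_valued_pinned hk.
  right=> x; have [_ -> // _ kw] := hk; apply: nlb; exists k; split=> //.
  exact: approximates_bounds kl'.
move=> /(_ w wl')[h [hr hF hnF] [_ hW]].
pose A : set nat := [set x | (inl x : alexandrov (@fan_rel _ L nat l')) \in F].
have [x xF] : exists x, ~ A x.
  apply: contrapT => nx.
  pose N := (\max_(y <- F) (if y is inl n then n else 0)).+1.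
  have : A N by apply: contrapT => ?; apply: nx; exists N.
  rewrite /A /= => NF.
  have := @leq_bigmax_seq _ _ predT
    (fun y : alexandrov (@fan_rel _ L nat l') => if y is inl n then n else 0) _ NF isT.
  by rewrite ltnn.
case: hW => [[y]|/(_ x)]; last by rewrite hnF.
have [yF|yF] := EM (A y); first by rewrite hF // => /(_ (lexx _)).
by rewrite hnF // => _ /(_ (lexx _)).
Qed.

Section chain.
Variable lt : L -> L -> Prop.
Hypothesis lt_wf : well_founded lt.
Hypothesis lt_trans : forall x y z, lt x y -> lt y z -> lt x z.
Hypothesis lt_total : forall x y, [\/ x = y, lt x y | lt y x].

Lemma lt_irr c : ~ lt c c.
Proof.
by elim/(well_founded_ind lt_wf): c => c IHc lt_cc; exact: (IHc _ lt_cc lt_cc).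
Qed.

Definition lower_bound_below J (c m : L) := forall b, J b -> lt b c -> m <= b.

Lemma common_upper_bound J b c : J b -> J c ->
    (forall b, J b -> exists2 c, J c & lt b c) ->
  exists e, [/\ J e, lt b e & lt c e].
Proof.
move=> Jb Jc Jmax; have [e Je be] := Jmax b Jb; have [f Jf cf] := Jmax c Jc.
have [ef|ef|fe] := lt_total e f; [subst f| |].
- by exists e.
- by exists f; split=> //; exact: lt_trans ef.
- by exists e; split=> //; exact: lt_trans fe.
Qed.

(** The Scott open set W consists of the maps h that separate at no c: among
the points of T where h is not a lower bound of the part of J before c, the trace
on J is not determined by the elements before c.  Only those c count for which v
is not a lower bound of that part. *)
Lemma chain_lower_bound l l' J v : approximates l l' -> bounds l' v ->
    (forall b, J b -> exists2 c, J c & lt b c) ->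
    (forall c, J c -> exists t, [/\ bounds l' t, t <= v & lower_bound_below J c t]) ->
  exists2 m, way_bounds l m & forall b, J b -> m <= b.
Proof.
move=> ll' vl' Jmax Jt; apply: contrapT => nlb.
have {}nlb m : way_bounds l m -> exists2 b, J b & ~ m <= b.
  move=> ml; apply: contrapT => nb; apply: nlb; exists m => // b Jb.
  by apply: contrapT => mb; apply: nb; exists b.
pose lb := lower_bound_below J.
pose agree (c : L) (x y : set L) := forall b, lt b c -> (x b <-> y b).
pose agreeJ (x y : set L) := forall b, J b -> (x b <-> y b).
pose X := alexandrov (@fan_rel _ L (set L) l').
pose C := scott_maps X L.
pose separates (h : C) (c : L) := [/\ J c, ~ lb c v &
  forall x y : set L, ~ lb c (h (inl x)) -> ~ lb c (h (inl y)) ->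
    agree c x y -> agreeJ x y].
pose W : set C := [set h | forall c, ~ separates h c].
have lbS b c m : lt b c \/ b = c -> lb c m -> lb b m.
  by move=> [bc|-> //] cm a Ja ab; apply: cm => //; exact: lt_trans bc.
have sepS (f g : C) c : f <= g -> separates g c -> separates f c.
  move=> /scott_maps_leP fg [Jc cv gc]; split=> // x y fx fy; apply: gc => glb.
    by apply: fx => b Jb bc; exact: le_trans (fg _) (glb b Jb bc).
  by apply: fy => b Jb bc; exact: le_trans (fg _) (glb b Jb bc).
have notlb c m : ~ lb c m -> exists b, [/\ J b, lt b c & ~ m <= b].
  move=> cm; apply: contrapT => nb; apply: cm => b Jb bc.
  by apply: contrapT => mb; apply: nb; exists b.
have oW : scott_open (@pinned _ L (set L) l l' `&` W).
  apply: scott_open_relative; first exact: scott_open_pinned.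
    by move=> f g fW fg c gc; apply: (fW c); exact: sepS gc.
  move=> D s dD Dl sD Ws; apply: contrapT => DW.
  have {DW} Dsep f : D f -> exists c, separates f c.
    move=> Df; apply: contrapT => nc; apply: DW; exists f => // c fc.
    by apply: nc; exists c.
  have [f0 Df0] := dD.1.
  pose bound : set L := [set c | J c /\
    forall f, D f -> exists2 b, separates f b & lt b c \/ b = c].
  have [/(wf_least lt_wf)[c [Jc cD] cmin]|nb] := EM (bound !=set0).
    (* All maps of D separate at elements up to c.  By minimality of c, for each
       b before c some map of D separates only after b; hence s separates at c. *)
    apply: (Ws c); split=> //.
      have [b [_ bv _] bc] := cD _ Df0.
      by move=> cv; apply/bv/lbS/cv.
    move=> x y /notlb[b1 [Jb1 b1c sxb1]] /notlb[b2 [Jb2 b2c syb2]] xy.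
    have [f1 Df1 f1x] := scott_maps_sup_mem Lc.1 dD sD (scott_open_notle b1) sxb1.
    have [f2 Df2 f2y] := scott_maps_sup_mem Lc.1 dD sD (scott_open_notle b2) syb2.
    have late b : J b -> lt b c -> exists2 f, D f &
        forall a, separates f a -> lt b a.
      move=> Jb bc; apply: contrapT => nf; apply: (cmin b bc); split=> // f Df.
      apply: contrapT => fb; apply: nf; exists f => // a fa.
      have [ab|ab|//] := lt_total a b; exfalso; apply: fb; exists a => //;
        [by right|by left].
    have [g1 Dg1 g1b] := late b1 Jb1 b1c; have [g2 Dg2 g2b] := late b2 Jb2 b2c.
    have [e1 [De1 fe1 ge1]] := dD.2 _ _ Df1 Dg1.
    have [e2 [De2 fe2 ge2]] := dD.2 _ _ Df2 Dg2.
    have [e [De e1e e2e]] := dD.2 _ _ De1 De2.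
    have [a ea ac] := cD _ De.
    have b1a : lt b1 a by apply/g1b/sepS/ea/(le_trans ge1).
    have b2a : lt b2 a by apply/g2b/sepS/ea/(le_trans ge2).
    have [_ _ eagree] := ea; apply: eagree.
    - move=> /(_ b1 Jb1 b1a) exb1; apply/f1x/le_trans/exb1.
      exact/scott_maps_leP/(le_trans fe1).
    - move=> /(_ b2 Jb2 b2a) eyb2; apply/f2y/le_trans/eyb2.
      exact/scott_maps_leP/(le_trans fe2).
    - move=> b ba; apply: xy; case: ac => [ac|<- //]; exact: lt_trans ac.
  (* Otherwise the maps of D, hence f0, separate at arbitrarily late elements.
     As no value of f0 is a lower bound of J, each x in T lies in the set
     separated by f0 at some c; this fails for a diagonal x. *)
  have [x xE] := wf_diagonal lt_wf (fun y c => ~ lb c (f0 (inl y))).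
  have [c [Jc f0x f0c]] : exists c, [/\ J c, ~ lb c (f0 (inl x)) &
      forall y z : set L, ~ lb c (f0 (inl y)) -> ~ lb c (f0 (inl z)) ->
        agree c y z -> agreeJ y z].
    have [b Jb xb] := nlb (f0 (inl x)) (pinned_way_bounds (Dl _ Df0)).
    have [f Df fb] : exists2 f, D f & forall c, separates f c -> lt b c.
      apply: contrapT => nf; apply: nb; exists b; split=> // f Df.
      apply: contrapT => fb; apply: nf; exists f => // c fc.
      have [cb|cb|//] := lt_total c b; exfalso; apply: fb; exists c => //;
        [by right|by left].
    have [g [Dg f0g fg]] := dD.2 _ _ Df0 Df.
    have [c gc] := Dsep _ Dg.
    have bc : lt b c by apply/fb/sepS/gc.
    have [Jc _ f0c] := sepS _ _ _ f0g gc.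
    by exists c; split=> // /(_ b Jb bc).
  have [xc|nxc] := EM (x c).
    by have /xE := xc; apply; exists x.
  apply/nxc/xE => -[y [yc yx yxc]].
  by apply/nxc/(f0c y x yc f0x yx c Jc).
(* The constant map v does not separate at c: the empty set and {c} have the same
   elements below c. *)
have [|F] := scott_open_two_valued
    (scott_isbell (core_compact_alexandrov (R := @fan_rel _ L (set L) l'))) oW _ vl'.
  move=> h hv; split; first exact: two_valued_pinned hv.
  have [_ hl _] := hv.
  move=> c [Jc cv hc].
  have nlbh x : ~ lb c (h (inl x)) by rewrite hl.
  have c0 : agree c set0 [set c].
    by move=> b bc; split=> // /= bE; rewrite bE in bc; exact: lt_irr bc.
  by have [_ /(_ erefl)] := hc _ _ (nlbh _) (nlbh _) c0 c Jc.
(* The finitely many traces on J of members of F are distinguished below some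
   c0, so the map equal to v on F and to a lower bound t of the initial segment
   of c0 elsewhere separates at c0. *)
have [b0 Jb0 vb0] := nlb v (approximates_bounds ll' vl').
have [c0 [Jc0 c0F]] : exists c, J c /\ (lt b0 c /\
    forall x y : set L, (inl x : X) \in F -> (inl y : X) \in F ->
      agree c x y -> agreeJ x y).
  have sep : forall G : seq (X * X), exists c, [/\ J c, lt b0 c &
      forall x y : set L, ((inl x : X), (inl y : X)) \in G -> agree c x y -> agreeJ x y].
    elim=> [|[p q] G [c [Jc b0c cG]]].
      by have [c Jc b0c] := Jmax _ Jb0; exists c.
    have [[b [x [y [px qy Jb xyb]]]]|none] := EM (exists b, exists x y : set L,
        [/\ p = inl x, q = inl y, J b & ~ (x b <-> y b)]).
      have [e [Je ce be]] := common_upper_bound Jc Jb Jmax.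
      exists e; split=> //; first exact: lt_trans ce.
      move=> x1 y1. rewrite in_cons => /orP[/eqP[x1p y1q]|xyG] xy.
        move: x1p y1q; rewrite px qy => -[x1E] [y1E].
        by have := xy b be; rewrite x1E y1E.
      by apply: cG xyG _ => a ac; apply: xy; exact: lt_trans ce.
    exists c; split=> // x y.
    rewrite in_cons => /orP[/eqP[px qy] _ b Jb|]; last exact: cG.
    by apply: contrapT => xyb; apply: none; exists b, x, y.
  have [c [Jc b0c cF]] := sep [seq (p, q) | p <- F, q <- F].
  exists c; split=> //; split=> // x y xF yF.
  by apply: cF; apply/allpairsP; exists (inl x, inl y).
have [b0c0 c0sep] := c0F.
have [t [tl' tv tc0]] := Jt _ Jc0.
move=> /(_ t tl')[h [_ hF hnF] [_ /(_ c0)]]; apply; split=> //.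
  by move=> /(_ b0 Jb0 b0c0).
have inF x : ~ lb c0 (h (inl x)) -> (inl x : X) \in F.
  move=> hx; apply: contrapT => xF; apply: hx.
  by rewrite hnF.
by move=> x y /inF xF /inF yF; exact: c0sep.
Qed.

End chain.

Lemma way_bounds_sub l : way_bounds l `<=` bounds l.
Proof. by move=> m ml u /ml/way_belowW. Qed.

Lemma seq_interpolation (A : set L) l :
    (forall u, u \in l -> exists2 a, A a & way_below u a) ->
  exists2 l1, approximates l l1 &
    forall u, u \in l1 -> exists2 a, A a & way_below u a.
Proof.
elim: l => [|u l IHl] lA; first by exists [::].
have [|l1 ll1 l1A] := IHl; first by move=> u' u'l; apply: lA; rewrite inE u'l orbT.
have [a Aa ua] := lA u (mem_head _ _).
have [w uw wa] := way_below_interpolation Lc ua.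
exists (w :: l1) => u'; rewrite inE => /orP[/eqP->|].
- by exists w => //; exact: mem_head.
- by move=> /ll1[a1 a1l1 u'a1]; exists a1 => //; rewrite inE a1l1 orbT.
- by exists a.
- exact: l1A.
Qed.

(** Transfinite induction along a well-order of N(l'), for all k approximated by
l' at once.  Each step uses lists strictly between k and l': a lower bound in
M(k2) is lowered under v inside M(k1) before the chain or pair lemma is applied
to k and k1. *)
Lemma bounds_lower_bound l l' : bounds l' !=set0 -> approximates l l' ->
  exists2 m, way_bounds l m & forall b, bounds l' b -> m <= b.
Proof.
move=> [v vl'] ll'; have [lt [lt_wf lt_trans lt_total]] := well_founded_order L.
have bounds_sub k : approximates k l' -> bounds l' `<=` bounds k.
  by move=> kl' m /(approximates_bounds kl')/way_bounds_sub.
have step J : J `<=` bounds l' ->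
    (forall c, J c -> forall k, approximates k l' ->
      exists2 m, way_bounds k m & lower_bound_below lt J c m) ->
    forall k, approximates k l' ->
    exists2 m, way_bounds k m & forall b, J b -> m <= b.
  move=> Jl' Jbelow k kl'.
  have [k1 kk1 k1l'] := @seq_interpolation [set` l'] _ kl'.
  have [k2 k1k2 k2l'] := @seq_interpolation [set` l'] _ k1l'.
  have below c : J c -> exists t, [/\ bounds k1 t, t <= v & lower_bound_below lt J c t].
    move=> Jc; have [m mk2 mc] := Jbelow c Jc k2 k2l'.
    have [t [tk1 tm tv]] := pair_lower_bound k1k2 (way_bounds_sub mk2)
      (bounds_sub _ k2l' _ vl').
    exists t; split=> //; first exact: way_bounds_sub.
    by move=> b Jb bc; exact: le_trans tm (mc b Jb bc).
  have [Jmax|] := EM (forall b, J b -> exists2 c, J c & lt b c).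
    exact: (chain_lower_bound lt_wf lt_trans lt_total kk1 (bounds_sub _ k1l' _ vl')).
  move=> /existsNP[c /not_implyP[Jc cmax]].
  have [t [tk1 _ tc]] := below c Jc.
  have [m [mk mt mc]] := pair_lower_bound kk1 tk1 (bounds_sub _ k1l' _ (Jl' _ Jc)).
  exists m => // b Jb; have [->//|bc|cb] := lt_total b c.
    exact: le_trans mt (tc b Jb bc).
  by case: cmax; exists b.
apply: (step (bounds l')) => // c _.
elim/(well_founded_ind lt_wf): c => c IHc k kl'.
have [|b [bl' bc] h hl'|m mk mc] := step [set b | bounds l' b /\ lt b c] _ _ k kl'.
- by move=> b [].
- have [m mh mb] := IHc b bc h hl'; exists m => // a [al' _]; exact: mb.
- by exists m => // b bl' bc; apply: mc.
Qed.

(** The supremum of A is that of the elements m lying below N(l), for l way below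
A.  By the previous lemma, such m can be taken way above any given list way below
A, which gives both directedness and m >= u for each u way below A. *)
Lemma isbell_scott_bounded_complete : bounded_complete L.
Proof.
move=> A [b0 Ab0].
pose below_A l := forall u, u \in l -> exists2 a, A a & way_below u a.
have below_bounds l : below_A l -> ubound A `<=` bounds l.
  by move=> lA b Ab u /lA[a Aa ua]; exact: le_trans (way_belowW ua) (Ab _ Aa).
pose D : set L := [set m | exists2 l, below_A l & forall b, bounds l b -> m <= b].
have inD l : below_A l -> exists2 m, D m & way_bounds l m.
  move=> lA; have [l' ll' l'A] := seq_interpolation lA.
  have [|m ml ml'] := @bounds_lower_bound l l' _ ll'.
    by exists b0; exact: below_bounds.
  by exists m => //; exists l'.
have dD : directed D.
  split=> [|m1 m2 [l1 l1A m1l] [l2 l2A m2l]].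
    by have [//|m Dm _] := inD [::]; exists m.
  have [|m Dm ml] := inD (l1 ++ l2).
    by move=> u; rewrite mem_cat => /orP[/l1A|/l2A].
  exists m; split=> //; [apply: m1l|apply: m2l] => u ul;
    by apply/way_belowW/ml; rewrite mem_cat ul ?orbT.
have [e De] := Lc.1 _ dD.
exists e; split=> [a Aa|b Ab].
  apply: (way_below_lub Lc) => u ua.
  have [|m Dm ml] := inD [:: u].
    by move=> u'; rewrite inE => /eqP->; exists a.
  apply: le_trans (De.1 _ Dm).
  by apply/way_belowW/ml; rewrite inE.
by apply: De.2 => m [l lA ml]; apply/ml/below_bounds/Ab.
Qed.

End lower_bounds.

Theorem theorem1p1 (d : Order.disp_t) (L : porderType d)
    (L_nonempty : [set: L] !=set0) (L_continuous : continuous_dcpo L) :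
  (forall X : topologicalType, core_compact X ->
     @open (isbell_topology X L) = @open (scott_topology (scott_maps X L)))
  <-> bounded_complete L.
Proof.
split=> [|bcL X Xc]; first exact: isbell_scott_bounded_complete.
apply/seteqP; split=> W; first exact: isbell_open_scott_open L_continuous.1.
exact: scott_open_isbell_open.
Qed.
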